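(* Let $D$ be a complete division ring of characteristic $0$, and let $p_n(x)=a_0xa_1x\cdots xa_n$ be a monomial of power $n$ in one variable $x$ over $D$ ($a_0,\dots,a_n\in D$). Then the Gâteaux derivative $\partial^mp_n(x)(h_1;\dots;h_m)$ is a symmetric polynomial with respect to the variables $h_1,\dots,h_m$.
   Context: A complete division ring of characteristic $0$ is a division ring $D$ of characteristic $0$ with an absolute value $|\cdot|:D\to\mathbb R$ ($|a|\ge0$, $|a|=0$ iff $a=0$, $|ab|=|a||b|$, $|a+b|\le|a|+|b|$), complete for the metric $|a-b|$, such that the embedding of the rational field $\mathbb Q$ (usual topology) into $D$ is a homeomorphism onto its image; then $\mathbb R$ is a subfield of the center $Z(D)$. A map $f:D\to D$ is differentiable in the Gâteaux sense if at every $x$ one has $f(x+a)-f(x)=\partial f(x)(a)+o(a)$, where $a\mapsto\partial f(x)(a)$ is linear (additive and homogeneous over $Z(D)$) and $o$ is a continuous map with $|o(a)|/|a|\to0$ as $a\to0$; then $\partial f(x)(a)=\lim_{t\to0,\,t\in\mathbb R}t^{-1}(f(x+ta)-f(x))$. Higher derivatives: $\partial^0f(x)=f(x)$ and $\partial^nf(x)(h_1;\dots;h_n)=\partial\big(\partial^{n-1}f(x)(h_1;\dots;h_{n-1})\big)(h_n)$, the outer $\partial$ being taken with respect to $x$. Symmetric means unchanged under every permutation of $h_1,\dots,h_m$. *)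

(* Defs.v *)
From HB Require Import structures.
From mathcomp Require Import all_boot all_order all_algebra all_fingroup.
From mathcomp Require Import all_classical all_reals all_analysis.
Set Implicit Arguments.
Unset Strict Implicit.
Unset Printing Implicit Defensive.
Import Order.TTheory GRing.Theory Num.Theory.
Import numFieldTopology.Exports numFieldNormedType.Exports.
Local Open Scope classical_set_scope.
Local Open Scope ring_scope.

Definition topological_embedding (S T : topologicalType) (f : S -> T) : Prop :=
  [/\ injective f, continuous f &
      forall U : set S, open U ->
        exists2 V : set T, open V & f @` U = V `&` range f].

(* [absv] is not an instance of the library norm: the latter requires
   [`|x *+ n| = `|x| *+ n], which fails for admissible absolute values such as
   the square root of the usual one on the real numbers. *)
HB.mixin Record hasAbsoluteValue (R : realType) D & GRing.UnitRing D := {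
  divring_axiom : GRing.field_axiom D ;
  absv : D -> R ;
  absv_ge0 : forall x : D, 0 <= absv x ;
  absv_eq0 : forall x : D, absv x = 0 <-> x = 0 ;
  absvM : forall x y : D, absv (x * y) = absv x * absv y ;
  absv_triangle : forall x y : D, absv (x + y) <= absv x + absv y
}.

#[short(type="valuedDivRingType")]
HB.structure Definition ValuedDivRing (R : realType) :=
  { D of GRing.UnitRing D & hasAbsoluteValue R D }.

(* [metric D] is D with the distance [absv (x - y)]; an alias is needed because
   the library does not allow to join [unitRingType] and [metricType] without
   going through its norms. *)
Definition metric (R : realType) (D : valuedDivRingType R) : Type := D.

Section Metric.
Context {R : realType} {D : valuedDivRingType R}.

Let dist (x y : metric D) : R := absv ((x : D) - (y : D)).

Let absvN (x : D) : absv (- x) = absv x.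
Proof.
have absv1 : absv (1 : D) = 1.
  have n0 : absv (1 : D) != 0 by apply/eqP => /absv_eq0/eqP; rewrite oner_eq0.
  by apply: (mulfI n0); rewrite -absvM !mulr1.
have absvN1 : absv (-1 : D) = 1.
  apply/eqP; rewrite -(@eqrXn2 _ 2) ?absv_ge0 ?ler01//.
  by rewrite expr2 -absvM mulrNN mulr1 absv1 expr1n.
by rewrite -mulN1r absvM absvN1 mul1r.
Qed.

Let distxx x : dist x x = 0. Proof. by apply/absv_eq0; rewrite subrr. Qed.

Let dist_eq0 x y : dist x y = 0 -> x = y.
Proof. by move=> /absv_eq0/eqP; rewrite subr_eq0 => /eqP. Qed.

Let dist_sym x y : dist x y = dist y x.
Proof. by rewrite /dist -absvN opprB. Qed.

Let dist_triangle y x z : dist x z <= dist x y + dist y z.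
Proof.
rewrite /dist; have := absv_triangle ((x : D) - (y : D)) ((y : D) - (z : D)).
by rewrite addrA subrK.
Qed.

HB.instance Definition _ := Choice.copy (metric D) D.
HB.instance Definition _ := isPointed.Build (metric D) (0 : D).
HB.instance Definition _ :=
  isMetric.Build R (metric D) distxx dist_eq0 dist_sym dist_triangle.

End Metric.

(* [rat^o] is [rat] with the topology of its usual absolute value. *)
HB.mixin Record isCompleteDivRing (R : realType) D & ValuedDivRing R D := {
  divring_pchar0 : [pchar D] =i pred0 ;
  metric_complete : forall F : set_system (metric D),
    ProperFilter F -> cauchy F -> cvg F ;
  ratr_embedding : topological_embedding (@ratr D : rat^o -> metric D)
}.

#[short(type="completeDivRingType")]
HB.structure Definition CompleteDivRing (R : realType) :=
  { D of ValuedDivRing R D & isCompleteDivRing R D }.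

HB.instance Definition _ (R : realType) (D : completeDivRingType R) :=
  Uniform_isComplete.Build (metric D) metric_complete.

Section Gateaux.
Context {R : realType} {D : completeDivRingType R}.
Implicit Types (f L : D -> D) (x h : D) (hs : seq D).

Definition central (z : D) : Prop := forall x, z * x = x * z.

Definition center_linear L : Prop :=
  (forall a b, L (a + b) = L a + L b) /\
  (forall z a, central z -> L (z * a) = z * L a).

Definition is_gateaux f x L : Prop :=
  center_linear L /\
  exists o : D -> D,
    [/\ continuous (o : metric D -> metric D),
        (fun a => absv (o a) / absv a) @ ((0 : D) : metric D)^' --> (0 : R) &
        forall a, f (x + a) - f x = L a + o a].

Definition gateaux_differentiable f : Prop :=
  forall x, exists L, is_gateaux f x L.

(* The map a |-> ∂f(x)(a); it is the zero map when no derivative exists. *)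
Definition gateaux f x : D -> D := xget (fun=> 0) [set L | is_gateaux f x L].

(* With hs = [:: h_1; ...; h_n], this is x |-> ∂^n f(x)(h_1; ...; h_n): the
   last direction of hs is the one differentiated along last. *)
Definition gateauxn f hs : D -> D :=
  foldl (fun g h => fun x => gateaux g x h) f hs.

(* All the differentiations involved in ∂^m f are genuine. *)
Definition gateaux_differentiablen (m : nat) f : Prop :=
  forall hs, (size hs < m)%N -> gateaux_differentiable (gateauxn f hs).

(* a_0 x a_1 x ... x a_n; the product is taken in increasing order of i. *)
Definition monomial n (a : 'I_n.+1 -> D) x : D :=
  a ord0 * \prod_(i < n) (x * a (lift ord0 i)).

(* c h_{i_1} c_1 h_{i_2} c_2 ... h_{i_k} c_k, where
   w = [:: (i_1, c_1); ...; (i_k, c_k)]. *)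
Definition monomial_in m (c : D) (w : seq ('I_m * D)) (h : m.-tuple D) : D :=
  c * \prod_(t <- w) (tnth h t.1 * t.2).

Definition is_polynomial m (F : m.-tuple D -> D) : Prop :=
  exists r : seq (D * seq ('I_m * D)),
    forall h : m.-tuple D, F h = \sum_(t <- r) monomial_in t.1 t.2 h.

Definition is_symmetric m (F : m.-tuple D -> D) : Prop :=
  forall (s : 'S_m) (h : m.-tuple D), F [tuple tnth h (s i) | i < m] = F h.

End Gateaux.

(* Main.v *)
Require Import Defs.
From mathcomp Require Import all_boot all_order all_algebra all_fingroup.
From mathcomp Require Import all_classical all_reals all_analysis.
From mathcomp Require Import lra.
(** The iterated derivatives of a monomial are computed formally. A polynomial
in the point x and in the directions h_i is written as a [term] built from
constants of D, the unknown, the directions, sums and products. Leibniz's rule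
gives an operation [derive] on terms, and [gateaux_eval] says that deriving a
term formally in the direction h_i has the effect of the Gateaux derivative
along h_i. Iterating, the m-th derivative of a monomial is again the value of a
term in x and h_1, ..., h_m. All differentiations are then genuine, and at a
fixed x the value of a term is a polynomial in the directions, since
polynomials contain the constants and the h_i and are closed under sum and
product ([is_polynomial_eval]).

Symmetry is the equality of mixed partial derivatives, which for terms is an
algebraic identity ([eval_deriveC]): both mixed derivatives of a product tu are
the sum of the same four products. A sequence of pairwise commuting operations
may be applied in any order ([perm_foldl]).

The link between the two derivatives has two parts. Existence: the Leibniz
formula is a Gateaux derivative because polynomials have a first-order
expansion with a remainder bounded by C|a|^2 for |a| <= 1, a property stable
under sums and products ([tangent_mul]). Uniqueness: two derivatives at the same
point differ by a map N, homogeneous over the center, with N(a)/a tending to 0;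
the ratio |N(a)|/|a| does not change when a is multiplied by a central element,
and there are arbitrarily small nonzero central elements, namely rational
numbers, so N = 0 ([gateaux_unique]). *)

Set Implicit Arguments.
Unset Strict Implicit.
Unset Printing Implicit Defensive.
Import Order.TTheory GRing.Theory Num.Theory.
Import numFieldTopology.Exports numFieldNormedType.Exports.
Local Open Scope classical_set_scope.
Local Open Scope ring_scope.

(** * Folding commuting operations *)

(** Commutation is only required on a stable class of states: Gateaux
derivatives commute on polynomial functions, not on all functions. *)
Lemma perm_foldl (T : Type) (I : eqType) (op : T -> I -> T) (P : T -> Prop) :
  (forall x i, P x -> P (op x i)) ->
  (forall x i j, P x -> op (op x i) j = op (op x j) i) ->
  forall (s t : seq I) x, P x -> perm_eq s t -> foldl op x s = foldl op x t.
Proof.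
move=> Pop opC.
have foldlC i s x : P x -> op (foldl op x s) i = foldl op (op x i) s.
  elim: s x => //= j s IHs x Px.
  by rewrite IHs; [rewrite opC | exact: Pop].
elim=> [|i s IHs] t x Px; first by rewrite perm_sym => /perm_nilP ->.
move=> eq_st; have : i \in t by rewrite -(perm_mem eq_st) mem_head.
move=> ti; case/splitPr: ti eq_st => p q.
rewrite perm_sym -cat1s perm_catCA perm_sym perm_cons => /IHs.
by rewrite /= => -> //; [rewrite !foldl_cat /= foldlC | exact: Pop].
Qed.

(** * The absolute value and small central elements *)

Section AbsoluteValue.
Context {R : realType} {D : completeDivRingType R}.
Implicit Types (x y z a b h : D).

Lemma absv0 : absv (0 : D) = 0. Proof. exact/absv_eq0. Qed.

Lemma absv_gt0 x : x != 0 -> 0 < absv x.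
Proof.
by move=> x0; rewrite lt_neqAle absv_ge0 andbT eq_sym; apply: contra_neq x0 => /absv_eq0.
Qed.

Lemma mdist_absv (x y : metric D) : mdist x y = absv ((x : D) - (y : D)).
Proof. by []. Qed.

Lemma absvB x y : absv (x - y) = absv (y - x).
Proof. by rewrite -!mdist_absv metric_sym. Qed.

Lemma absvN x : absv (- x) = absv x.
Proof. by rewrite -[- x]sub0r absvB subr0. Qed.

Lemma ball_absv (x y : metric D) (e : R) :
  ball x e y <-> absv ((x : D) - (y : D)) < e.
Proof. by rewrite ballEmdist. Qed.

Lemma central_ratr (q : rat) : central (ratr q : D).
Proof.
move=> x; apply/esym/commrM; first exact: commr_int.
exact/commrV/commr_int.
Qed.

(** The rational numbers are central, and they come close to 0 in D because
their embedding is continuous for the usual topology. *)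
Lemma central_small (d : R) : 0 < d ->
  exists z : D, [/\ central z, z != 0 & absv z < d].
Proof.
move=> d0; have [inj_ratr ratr_cont _] := @ratr_embedding R D.
have ratr0 : ratr 0 = 0 :> D by rewrite (ratr_nat _ 0).
have : nbhs (0 : rat^o) ((@ratr D : rat^o -> metric D) @^-1` ball (ratr 0 : metric D) d).
  exact/ratr_cont/nbhsx_ballx.
move=> /nbhs_ballP[e /= e0 sub_e].
exists (ratr (e / 2)); split; first exact: central_ratr.
  apply/eqP; rewrite -ratr0 => /inj_ratr/eqP.
  by rewrite gt_eqF// divr_gt0.
have /sub_e/ball_absv : ball (0 : rat^o) e (e / 2).
  rewrite -ball_normE /= sub0r normrN gtr0_norm ?divr_gt0//.
  by rewrite ltr_pdivrMr// mulr_natr mulr2n ltrDl.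
by rewrite ratr0 sub0r absvN.
Qed.

End AbsoluteValue.

(** * First-order expansions with quadratic remainder *)

Section Tangent.
Context {R : realType} {D : completeDivRingType R}.
Implicit Types (f g L : D -> D) (x y a h : D).

(** A quantitative strengthening of Gateaux differentiability. The bound on L
and the quadratic remainder, asked only for |a| <= 1, make the property stable
under products, where the cross term L(a)M(a) is itself quadratic; mere
center-linearity of L would not control that term. *)
Definition tangent f x L : Prop :=
  center_linear L /\
  exists2 C : R, 0 <= C & forall a,
    absv (L a) <= C * absv a /\
    (absv a <= 1 -> absv (f (x + a) - f x - L a) <= C * absv a ^+ 2).

Lemma tangent_cst c x : tangent (fun=> c) x (fun=> 0).
Proof.
split; first by split=> *; rewrite ?addr0 ?mulr0.
by exists 0 => // a; rewrite !subrr absv0 !mul0r.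
Qed.

Lemma tangent_id x : tangent id x id.
Proof.
split; first by split.
exists 1 => // a; rewrite mul1r; split=> // _.
by rewrite [x + a]addrC addrK subrr absv0 mul1r exprn_ge0// absv_ge0.
Qed.

Lemma tangent_add f g x L M : tangent f x L -> tangent g x M ->
  tangent (fun y => f y + g y) x (fun a => L a + M a).
Proof.
move=> [[LD LZ] [C C0 fC]] [[MD MZ] [K K0 gK]]; split.
  split=> [a b|z a zZ]; first by rewrite LD MD addrACA.
  by rewrite LZ// MZ// mulrDr.
exists (C + K) => [|a]; first exact: addr_ge0.
have [La fa] := fC a; have [Ma ga] := gK a.
rewrite !mulrDl; split=> [|a1].
  by apply: le_trans (absv_triangle _ _) _; exact: lerD.
have -> : f (x + a) + g (x + a) - (f x + g x) - (L a + M a) =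
    (f (x + a) - f x - L a) + (g (x + a) - g x - M a).
  by rewrite !opprD [X in X + _ = _]addrACA [LHS]addrACA.
apply: le_trans (absv_triangle _ _) _; apply: lerD; [exact: fa|exact: ga].
Qed.

Lemma tangent_lipschitz f x L : tangent f x L ->
  exists2 C : R, 0 <= C &
    forall a, absv a <= 1 -> absv (f (x + a) - f x) <= C * absv a.
Proof.
move=> [_ [C C0 fC]]; exists (C + C) => [|a a1]; first exact: addr_ge0.
have [La /(_ a1) fa] := fC a.
have -> : f (x + a) - f x = (f (x + a) - f x - L a) + L a by rewrite subrK.
apply: le_trans (absv_triangle _ _) _; rewrite mulrDl; apply: lerD => //.
apply: le_trans fa _; apply: ler_wpM2l => //.
by rewrite expr2 ler_piMl ?absv_ge0.
Qed.

Lemma tangent_mul f g x L M : tangent f x L -> tangent g x M ->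
  tangent (fun y => f y * g y) x (fun a => L a * g x + f x * M a).
Proof.
move=> fL gM; have [B B0 gB] := tangent_lipschitz gM.
move: fL gM => [[LD LZ] [C C0 fC]] [[MD MZ] [K K0 gK]]; split.
  split=> [a b|z a zZ]; first by rewrite LD MD mulrDl mulrDr addrACA.
  by rewrite LZ// MZ// mulrDr !mulrA (zZ (f x)).
exists (C * (absv (g x) + B) + C * B + absv (f x) * K) => [|a].
  by rewrite !(addr_ge0, mulr_ge0)// absv_ge0.
have [La fa] := fC a; have [Ma ga] := gK a.
have gx0 := absv_ge0 (g x); have fx0 := absv_ge0 (f x).
have a0 := absv_ge0 a.
split=> [|a1].
  apply: le_trans (absv_triangle _ _) _; rewrite !absvM.
  have H1 : absv (L a) * absv (g x) <= C * absv a * absv (g x).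
    exact: ler_wpM2r.
  have H2 : absv (f x) * absv (M a) <= absv (f x) * (K * absv a).
    exact: ler_wpM2l.
  have H3 : 0 <= C * B * absv a by rewrite !mulr_ge0.
  lra.
have {}fa := fa a1; have {}ga := ga a1; have {}gB := gB a a1.
set rf := _ - _ - L a in fa; set rg := _ - _ - M a in ga.
(* Replacing one factor at a time, first f(x + a) and then g(x + a), leaves
   three terms of order |a|^2. *)
have -> : f (x + a) * g (x + a) - f x * g x - (L a * g x + f x * M a) =
    rf * g (x + a) + L a * (g (x + a) - g x) + f x * rg.
  rewrite /rf /rg !mulrBl !mulrBr opprD.
  rewrite [X in _ = X + _]addrA subrK.
  rewrite [X in _ = X + _]addrAC !addrA subrK.
  by rewrite [X in X - _ = _]addrAC.
apply: le_trans (absv_triangle _ _) _.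
have T := absv_triangle (rf * g (x + a)) (L a * (g (x + a) - g x)).
rewrite !absvM in T *.
have gxa : absv (g (x + a)) <= absv (g x) + B.
  have -> : g (x + a) = g x + (g (x + a) - g x) by rewrite [RHS]addrC subrK.
  apply: le_trans (absv_triangle _ _) _; rewrite lerD2l.
  by apply: le_trans gB _; rewrite ler_piMr.
have H1 : absv rf * absv (g (x + a)) <= C * absv a ^+ 2 * (absv (g x) + B).
  by apply: ler_pM; rewrite ?absv_ge0.
have H2 : absv (L a) * absv (g (x + a) - g x) <= C * absv a * (B * absv a).
  by apply: ler_pM; rewrite ?absv_ge0.
have H3 : absv (f x) * absv rg <= absv (f x) * (K * absv a ^+ 2).
  exact: ler_wpM2l.
lra.
Qed.

Lemma lipschitz_at_continuous f :
  (forall x, exists2 C : R, 0 <= C &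
    forall a, absv a <= 1 -> absv (f (x + a) - f x) <= C * absv a) ->
  continuous (f : metric D -> metric D).
Proof.
move=> fC x; have [C C0 {}fC] := fC x.
apply/(@cvg_ballP _ _ _ _ (nbhs_filter (x : metric D))) => e e0.
have d0 : 0 < Num.min 1 (e / (C + 1)).
  by rewrite lt_min ltr01 divr_gt0// ltr_wpDl.
apply/nbhs_ballP; exists (Num.min 1 (e / (C + 1))) => //= y.
move=> /ball_absv; rewrite absvB lt_min => /andP[/ltW y1 ye].
apply/ball_absv; rewrite absvB.
have -> : f y = f ((x : D) + ((y : D) - x)) by rewrite addrC subrK.
apply: le_lt_trans (fC _ y1) _.
rewrite ltr_pdivlMr in ye; last by rewrite ltr_wpDl.
apply: le_lt_trans ye; rewrite mulrC ler_wpM2l ?absv_ge0//; lra.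
Qed.

(** Expansions are needed at every point: the remainder has to be continuous at
every increment a, which follows from the expansion of f at x + a. *)
Lemma tangent_is_gateaux f (Df : D -> D -> D) :
  (forall x, tangent f x (Df x)) -> forall x, is_gateaux f x (Df x).
Proof.
move=> fDf x; have [[LD LZ] [C C0 fC]] := fDf x; split; first by split.
exists (fun a => f (x + a) - f x - Df x a); split; last first.
- by move=> a; rewrite [RHS]addrC subrK.
- apply/cvg_ballP => e e0; rewrite near_withinE.
  have d0 : 0 < Num.min 1 (e / (C + 1)).
    by rewrite lt_min ltr01 divr_gt0// ltr_wpDl.
  apply/nbhs_ballP; exists (Num.min 1 (e / (C + 1))) => //= a.
  move=> /ball_absv; rewrite sub0r absvN lt_min => /andP[/ltW a1 ae] a0.
  have {}a0 := absv_gt0 a0.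
  rewrite -ball_normE /= sub0r normrN ger0_norm ?divr_ge0 ?absv_ge0//.
  rewrite ltr_pdivrMr//; apply: le_lt_trans ((fC a).2 a1) _.
  rewrite expr2 mulrA ltr_pM2r// mulrC.
  rewrite ltr_pdivlMr in ae; last by rewrite ltr_wpDl.
  by apply: le_lt_trans ae; rewrite ler_wpM2l ?absv_ge0//; lra.
apply: lipschitz_at_continuous => a.
have [K K0 fK] := tangent_lipschitz (fDf (x + a)).
exists (K + C) => [|b b1]; first exact: addr_ge0.
have -> : f (x + (a + b)) - f x - Df x (a + b) - (f (x + a) - f x - Df x a)
    = (f (x + a + b) - f (x + a)) - Df x b.
  rewrite LD addrA; set u := f _; set v := f (x + a).
  rewrite !opprD !opprK !addrA.
  by rewrite [LHS](ACl (1*5*4*(2*6)*(3*7)))/= !addNr !addr0.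
apply: le_trans (absv_triangle _ _) _; rewrite absvN mulrDl.
by apply: lerD; [exact: fK | exact: (fC b).1].
Qed.

(** For a fixed a, the number |L(za) - M(za)| / |za| is independent of the
central element z and tends to 0 with z, so it is 0. *)
Lemma gateaux_unique f x L M :
  is_gateaux f x L -> is_gateaux f x M -> L = M.
Proof.
move=> [[_ LZ] [ o [_ ocvg oE]]] [[_ MZ] [p [_ pcvg pE]]].
apply/funext => a; apply/eqP; rewrite -subr_eq0; apply/negPn/negP => N0.
have a0 : a != 0.
  apply: contraNneq N0 => ->; rewrite -(mulr0 0).
  have Z0 : central (0 : D) by move=> y; rewrite mul0r mulr0.
  by rewrite LZ// MZ// !mul0r subrr.
have aa := absv_gt0 a0; have NN := absv_gt0 N0.
set N := L a - M a in N0 NN.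
(* Each remainder is below half of |N(a)|/|a|, relatively to the increment, so
   that their difference cannot be as large as N. *)
pose e := absv N / absv a / 2.
have e0 : 0 < e by rewrite !divr_gt0.
have : \forall b \near (0 : metric D)^',
    absv (o b) / absv b < e /\ absv (p b) / absv b < e.
  have cvg_lt (q : D -> D) :
      (fun a => absv (q a) / absv a) @ ((0 : D) : metric D)^' --> (0 : R) ->
      \forall b \near (0 : metric D)^', absv (q b) / absv b < e.
    move=> /cvg_ballP/(_ _ e0); apply: filterS => b.
    by rewrite -ball_normE /= sub0r normrN ger0_norm ?divr_ge0 ?absv_ge0.
  by apply: filterI; exact: cvg_lt.
rewrite near_withinE => /nbhs_ballP[d /= d0 sub_d].
have [z [zZ z0 zd]] : exists z : D, [/\ central z, z != 0 & absv z < d / absv a].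
  by apply: central_small; rewrite divr_gt0.
have za0 : z * a != 0.
  apply/eqP => /absv_eq0/eqP; rewrite absvM mulf_eq0.
  by rewrite !gt_eqF ?absv_gt0.
have [||oz pz] := sub_d (z * a).
- by apply/ball_absv; rewrite sub0r absvN absvM -ltr_pdivlMr.
- exact: za0.
have zN : z * N = p (z * a) - o (z * a).
  rewrite /N mulrBr -LZ// -MZ//.
  have := oE (z * a); rewrite pE => eq_op.
  by apply/eqP; rewrite subr_eq addrAC eq_sym subr_eq addrC eq_op.
have zaa := absv_gt0 za0.
rewrite !ltr_pdivrMr// in oz pz.
have := absv_triangle (p (z * a)) (- o (z * a)).
rewrite absvN -zN absvM.
have : absv (p (z * a)) + absv (o (z * a)) < absv z * absv N.
  have -> : absv z * absv N = e * absv (z * a) + e * absv (z * a).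
    rewrite -mulrDl /e -splitr absvM mulrC [absv z * _]mulrC mulrA divfK//.
    by rewrite gt_eqF.
  exact: ltrD.
by move=> /lt_le_trans h /h; rewrite ltxx.
Qed.

Lemma gateauxE f x L : is_gateaux f x L -> gateaux f x = L.
Proof.
move=> fL; apply: xget_unique => // M fM; exact: gateaux_unique fM fL.
Qed.

End Tangent.

(** * Formal terms and their derivatives *)

Section Terms.
Context {R : realType} {D : completeDivRingType R} {I : Type}.

Inductive term : Type :=
| Cst of D
| Unknown
| Direction of I
| Add of term & term
| Mul of term & term.

Fixpoint eval (h : I -> D) (t : term) (x : D) : D :=
  match t with
  | Cst c => c
  | Unknown => x
  | Direction i => h i
  | Add t u => eval h t x + eval h u x
  | Mul t u => eval h t x * eval h u x
  end.

Fixpoint derive (t : term) (i : I) : term :=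
  match t with
  | Cst _ | Direction _ => Cst 0
  | Unknown => Direction i
  | Add t u => Add (derive t i) (derive u i)
  | Mul t u => Add (Mul (derive t i) u) (Mul t (derive u i))
  end.

Lemma eval_deriveC h t i j x :
  eval h (derive (derive t i) j) x = eval h (derive (derive t j) i) x.
Proof.
elim: t => //= [t -> u -> //|t IHt u IHu].
by rewrite IHt IHu -!addrA; congr (_ + _); rewrite !addrA; congr (_ + _); rewrite addrC.
Qed.

(** The differential of the value of a term at x, for an increment a of the
unknown that need not be one of the directions h_i. *)
Fixpoint slope (h : I -> D) (t : term) (x a : D) : D :=
  match t with
  | Cst _ | Direction _ => 0
  | Unknown => a
  | Add t u => slope h t x a + slope h u x a
  | Mul t u => slope h t x a * eval h u x + eval h t x * slope h u x a
  end.

Lemma slope_derive h t x i : slope h t x (h i) = eval h (derive t i) x.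
Proof. by elim: t => //= t -> u ->. Qed.

Lemma tangent_eval h t x : tangent (eval h t) x (slope h t x).
Proof.
elim: t => [c||i|t IHt u IHu|t IHt u IHu] /=.
- exact: tangent_cst.
- exact: tangent_id.
- exact: tangent_cst.
- exact: tangent_add.
- exact: tangent_mul.
Qed.

Lemma is_gateaux_eval h t x : is_gateaux (eval h t) x (slope h t x).
Proof. exact: tangent_is_gateaux (tangent_eval h t) x. Qed.

Lemma gateaux_eval h t i :
  (fun x => gateaux (eval h t) x (h i)) = eval h (derive t i).
Proof.
apply/funext => x.
by rewrite (gateauxE (is_gateaux_eval h t x)) slope_derive.
Qed.

Lemma gateauxn_eval h t js :
  gateauxn (eval h t) (map h js) = eval h (foldl derive t js).
Proof.
by rewrite /gateauxn; elim: js t => //= j js IHjs t; rewrite gateaux_eval IHjs.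
Qed.

Definition monomial_term n (a : 'I_n.+1 -> D) : term :=
  Mul (Cst (a ord0))
      (\big[Mul/Cst 1]_(i < n) Mul Unknown (Cst (a (lift ord0 i)))).

Lemma eval_monomial h n (a : 'I_n.+1 -> D) :
  eval h (monomial_term a) = monomial a.
Proof.
apply/funext => x; rewrite /monomial_term /monomial /=; congr (_ * _).
by apply: (big_ind2 (fun t y => eval h t x = y)) => //= t y u z -> ->.
Qed.

End Terms.
Arguments term {R} D I.

(** * Symmetry *)

Section Symmetry.
Context {R : realType} {D : completeDivRingType R}.

(** The directions are indexed by D itself, so that any sequence of vectors is a
sequence of directions. *)
Lemma gateauxn_perm (t : term D D) (hs ks : seq D) : perm_eq hs ks ->
  gateauxn (eval id t) hs = gateauxn (eval id t) ks.
Proof.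
apply: (@perm_foldl _ _ _ (fun f => exists u : term D D, f = eval id u)).
- by move=> f h [u ->]; exists (derive u h); exact: (gateaux_eval id).
- move=> f h k [u ->].
  rewrite !(gateaux_eval id u) (gateaux_eval id _ k) (gateaux_eval id _ h).
  by apply/funext => x; exact: eval_deriveC.
by exists t.
Qed.

End Symmetry.

(** * Polynomials in the directions *)

Section Polynomials.
Context {R : realType} {D : completeDivRingType R} {m : nat}.
Implicit Types F G : m.-tuple D -> D.

Lemma is_polynomial_cst (c : D) : is_polynomial (fun _ : m.-tuple D => c).
Proof.
by exists [:: (c, [::])] => h; rewrite big_seq1 /monomial_in big_nil mulr1.
Qed.

Lemma is_polynomial_tnth i : is_polynomial (fun h : m.-tuple D => tnth h i).
Proof.
exists [:: (1, [:: (i, 1)])] => h.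
by rewrite big_seq1 /monomial_in big_seq1 mulr1 mul1r.
Qed.

Lemma is_polynomial_add F G : is_polynomial F -> is_polynomial G ->
  is_polynomial (fun h => F h + G h).
Proof. by move=> [r Fr] [s Gs]; exists (r ++ s) => h; rewrite big_cat Fr Gs. Qed.

Lemma is_polynomial_cstM c G : is_polynomial G ->
  is_polynomial (fun h => c * G h).
Proof.
move=> [r Gr]; exists [seq (c * t.1, t.2) | t <- r] => h.
rewrite Gr big_map big_distrr; apply: eq_bigr => t _.
by rewrite /monomial_in /= mulrA.
Qed.

Lemma is_polynomial_tnthM i G : is_polynomial G ->
  is_polynomial (fun h => tnth h i * G h).
Proof.
move=> [r Gr]; exists [seq (1, (i, t.1) :: t.2) | t <- r] => h.
rewrite Gr big_map big_distrr; apply: eq_bigr => t _.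
by rewrite /monomial_in /= big_cons mul1r mulrA.
Qed.

(** A polynomial is assembled from sums and left multiplications by constants
and variables, each of which acts directly on the list of monomials of G; no
normal form for a product of two monomials has to be chosen. *)
Lemma is_polynomial_mul F G : is_polynomial F -> is_polynomial G ->
  is_polynomial (fun h => F h * G h).
Proof.
move=> [r /funext ->] pG; elim: r => [|[c w] r IHr].
  under eq_fun do rewrite big_nil mul0r.
  exact: is_polynomial_cst.
under eq_fun do rewrite big_cons mulrDl.
apply: is_polynomial_add => //; rewrite /monomial_in /=.
under eq_fun do rewrite -mulrA.
apply: is_polynomial_cstM; elim: w => [|[i d] w IHw].
  by under eq_fun do rewrite big_nil mul1r.
under eq_fun do rewrite big_cons -!mulrA.
exact/is_polynomial_tnthM/is_polynomial_cstM.
Qed.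

Lemma is_polynomial_eval (t : term D 'I_m) x :
  is_polynomial (fun h : m.-tuple D => eval (tnth h) t x).
Proof.
elim: t => [c||i|t IHt u IHu|t IHt u IHu] /=.
- exact: is_polynomial_cst.
- exact: is_polynomial_cst.
- exact: is_polynomial_tnth.
- exact: is_polynomial_add.
- exact: is_polynomial_mul.
Qed.

End Polynomials.

Theorem theorem9p2 (R : realType) (D : completeDivRingType R) (n m : nat)
    (a : 'I_n.+1 -> D) :
  gateaux_differentiablen m (monomial a) /\
  forall x : D,
    is_polynomial (fun h : m.-tuple D => gateauxn (monomial a) h x) /\
    is_symmetric (fun h : m.-tuple D => gateauxn (monomial a) h x).
Proof.
split=> [hs _ x|x].
  rewrite -(eval_monomial id) -[hs]map_id gateauxn_eval.
  by eexists; exact: is_gateaux_eval.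
split.
  have -> : (fun h : m.-tuple D => gateauxn (monomial a) h x) =
      (fun h => eval (tnth h) (foldl derive (monomial_term a) (enum 'I_m)) x).
    apply/funext => h.
    by rewrite -{1}(map_tnth_enum h) -(eval_monomial (tnth h)) gateauxn_eval.
  exact: is_polynomial_eval.
move=> s h; rewrite -(eval_monomial id).
by congr (_ x); apply/gateauxn_perm/tuple_permP; exists s.
Qed.
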